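(* Let $\lambda\in\mathbb{R}$, let $k\ge 0$ and $n\ge k$ be integers (with $n\in\mathbb{N}$), and let $U_1,\ldots,U_k$ be independent random variables uniformly distributed on $(0,1)$. Then \[ S_{2,\lambda}(n,k)=\sum_{m=k}^n \binom{m}{k}\, S_{1,\lambda}(n,m)\, E\big[(U_1+\cdots+U_k)^{m-k}\big]. \]
   Context: For $\lambda\neq0$, the degenerate Stirling numbers of the second kind are defined by $\frac{1}{k!}\big((1+\lambda t)^{1/\lambda}-1\big)^k=\sum_{n=k}^\infty S_{2,\lambda}(n,k)\frac{t^n}{n!}$, and the degenerate Stirling numbers of the first kind by $\frac{1}{k!}\big(\log(1+\lambda t)^{1/\lambda}\big)^k=\sum_{n=k}^\infty S_{1,\lambda}(n,k)\frac{t^n}{n!}$; for $\lambda=0$ these are read with $(1+\lambda t)^{1/\lambda}=e^t$ and $\log(1+\lambda t)^{1/\lambda}=t$. Equivalently, $(x)_{n,\lambda}=\sum_{l=0}^n S_{1,\lambda}(n,l)x^l$ with $(x)_{0,\lambda}=1$, $(x)_{n,\lambda}=x(x-\lambda)\cdots(x-(n-1)\lambda)$. The convention $0^0=1$ is used. *)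

(* Defs.v *)
From HB Require Import structures.
From mathcomp Require Export all_boot all_order all_algebra.
From mathcomp Require Export all_classical all_reals all_analysis.
Export Order.TTheory GRing.Theory Num.Theory.
Export numFieldNormedType.Exports.

Set Implicit Arguments.
Unset Strict Implicit.
Unset Printing Implicit Defensive.

Local Open Scope classical_set_scope.
Local Open Scope ring_scope.

(* (1 + lambda t)^(1/lambda), read as e^t when lambda = 0. *)
Definition degenerate_exp (R : realType) (lambda t : R) : R :=
  if lambda == 0 then expR t else (1 + lambda * t) `^ lambda^-1.

(* log (1 + lambda t)^(1/lambda), read as t when lambda = 0. *)
Definition log_degenerate_exp (R : realType) (lambda t : R) : R :=
  if lambda == 0 then t else ln ((1 + lambda * t) `^ lambda^-1).

(* For every t close to 0, the series of a_n t^n / n! over n >= k converges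
   with sum f t.  The terms a_n with n < k play no role. *)
Definition egf_expansion_from (R : realType) (k : nat) (a : nat -> R)
    (f : R -> R) : Prop :=
  \forall t \near (0 : R),
    (fun N : nat => \sum_(k <= n < N) a n * t ^+ n / n`!%:R) @ \oo --> f t.

(* S n k stands for S_{2,lambda}(n,k); the values S n k with k <= n are
   determined by this predicate, those with n < k are irrelevant. *)
Definition degenerate_stirling2 (R : realType) (lambda : R)
    (S : nat -> nat -> R) : Prop :=
  forall k : nat, egf_expansion_from k (fun n => S n k)
    (fun t => k`!%:R^-1 * (degenerate_exp lambda t - 1) ^+ k).

(* S n k stands for S_{1,lambda}(n,k), with the same conventions. *)
Definition degenerate_stirling1 (R : realType) (lambda : R)
    (S : nat -> nat -> R) : Prop :=
  forall k : nat, egf_expansion_from k (fun n => S n k)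
    (fun t => k`!%:R^-1 * log_degenerate_exp lambda t ^+ k).

Definition mutually_independent (d : measure_display) (T : measurableType d)
    (R : realType) (P : probability T R) (k : nat)
    (X : 'I_k -> {RV P >-> R}) : Prop :=
  forall (J : {set 'I_k}) (B : 'I_k -> set R),
    (forall i, i \in J -> measurable (B i)) ->
    P (\bigcap_(i in [set` J]) (X i @^-1` B i)) =
    (\prod_(i in J) P (X i @^-1` B i))%E.

(* The law is the uniform probability with density 1 on the closed interval
   [0, 1], which is the same measure as the one on the open interval. *)
Definition uniform01 (d : measure_display) (T : measurableType d)
    (R : realType) (P : probability T R) (X : {RV P >-> R}) : Prop :=
  forall B : set R, measurable B ->
    distribution P X B = uniform_prob (@ltr01 R) B.

(* Main.v *)
(* Both families of degenerate Stirling numbers are coefficients of h^k/k! with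
   (1 + lambda t) h' = 1 + e h, where e = 0 for the first kind and e = 1 for the
   second, so comparing power series gives triangular recurrences for both.
   Hence p_n(x) = sum_m S1(n,m) x^m is the degenerate falling factorial
   (x)_{n,lambda}, and k! S2(n,k) satisfies the recurrence of Delta^k p_n(0),
   Delta being the forward difference.  On the probabilistic side,
   E[f^(k)(U_1 + ... + U_k)] = Delta^k f(0), which for f = x^m reads
   m^_k E[(U_1 + ... + U_k)^(m-k)] = Delta^k x^m (0); expanding p_n in
   monomials gives the identity. *)
From HB Require Import structures.
Require Import Defs.
From mathcomp Require Import measurable_realfun ring lra.

Local Open Scope ring_scope.

(** * Power series near 0 and differential equations for generating functions *)

Section ExponentialGeneratingFunctions.
Local Open Scope classical_set_scope.

(** The left side is one term of the binomial expansion of the right side. It lets a slightly larger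
    radius absorb the factor [n.+1] created by differentiation. *)
Lemma mulrn_exp_le_exprD (R : realDomainType) (a h : R) n : 0 <= a -> 0 <= h ->
  n.+1%:R * a ^+ n * h <= (a + h) ^+ n.+1.
Proof.
move=> a0 h0; elim: n => [|n IH]; first by rewrite mul1r mul1r lerDr.
have -> : n.+2%:R * a ^+ n.+1 * h =
    a * (n.+1%:R * a ^+ n * h) + h * a ^+ n.+1.
  by rewrite exprS -natr1; ring.
rewrite [leRHS]exprS mulrDl lerD ?ler_wpM2l//.
by rewrite lerXn2r ?nnegrE ?addr_ge0// lerDl.
Qed.

Lemma is_cvg_pseries_diffs (R : realType) (c : nat -> R) x z :
  cvgn (pseries c x) -> `|z| < `|x| -> cvgn (pseries (pseries_diffs c) z).
Proof.
(* [w] is the midpoint of |z| and |x|, and [h] its distance to |z|: the bound (n+1) |z|^n <= w^(n+1)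
   / h then dominates the differentiated series. *)
move=> cx zx; pose w := (`|z| + `|x|) / 2; pose h := w - `|z|.
have h0 : 0 < h by rewrite /h /w; lra.
have w0 : 0 <= w by rewrite /w divr_ge0 ?addr_ge0.
have cw : cvgn (pseries (fun n => `|c n|) w).
  by apply: is_cvg_pseries_inside_norm cx _; rewrite ger0_norm// /w; lra.
have cw' : cvgn (series (fun n => `|c n.+1| * w ^+ n.+1 / h)).
  apply: (cvgP ((limn (pseries (fun n => `|c n|) w) - `|c 0%N|) / h)).
  have -> : series (fun n => `|c n.+1| * w ^+ n.+1 / h) =
      (fun n => (pseries (fun n => `|c n|) w n.+1 - `|c 0%N|) / h).
    apply/funext => n; rewrite /pseries/series/= big_nat_recl//= mulr1.
    rewrite addrC addKr.
    by rewrite mulr_suml.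
  apply: cvgMl; apply: cvgB; last exact: cvg_cst.
  by rewrite (cvg_shiftS (pseries _ w)).
apply: normed_cvg.
apply: series_le_cvg cw' => [n|n|n] /=.
- exact: normr_ge0.
- by rewrite divr_ge0 ?mulr_ge0 ?exprn_ge0// ltW.
have -> : `|pseries_diffs c n * z ^+ n| = `|c n.+1| * (n.+1%:R * `|z| ^+ n).
  by rewrite /pseries_diffs !normrM normrX normr_nat; ring.
rewrite -mulrA ler_wpM2l// ler_pdivlMr//.
by rewrite (le_trans (mulrn_exp_le_exprD _ _ _ _ _ (ltW h0)))// /h addrC subrK.
Qed.

Lemma derive_pseries (R : realType) (c : nat -> R) (f : R -> R) :
  (\forall t \near (0 : R), pseries c t @ \oo --> f t) ->
  \forall t \near (0 : R), exists2 l : R, is_derive (t : R) (1 : R) f l &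
    pseries (pseries_diffs c) t @ \oo --> l.
Proof.
move=> /nbhs_ballP[r /= r0 rP].
have cc t : `|t| < r -> pseries c t @ \oo --> f t.
  by move=> tr; apply: rP; rewrite /ball/= sub0r normrN.
(* [K t] lies strictly between |t| and r, so differentiating a series does not shrink the ball on
   which it converges. *)
pose K (t : R) : R := (`|t| + r) / 2.
have KP (t : R) : `|t| < r -> `|t| < `|K t| /\ `|K t| < r.
  move=> tr; have K0 : 0 <= K t by rewrite /K divr_ge0// addr_ge0// ltW.
  by rewrite (ger0_norm K0) /K; split; lra.
have dc (b : nat -> R) : (forall t, `|t| < r -> cvgn (pseries b t)) ->
    forall t, `|t| < r -> cvgn (pseries (pseries_diffs b) t).
  by move=> hb t /KP[tK Kr]; apply: (is_cvg_pseries_diffs _ _ (K t)); auto.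
have c0 t : `|t| < r -> cvgn (pseries c t) by move=> /cc/cvgP; exact.
have c1 := dc _ c0; have c2 := dc _ c1.
apply/nbhs_ballP; exists r => //= t; rewrite /ball/= sub0r normrN => tr.
exists (limn (pseries (pseries_diffs c) t)); last exact: c1.
have [tK Kr] := KP _ tr.
have D := pseries_snd_diffs (c0 _ Kr) (c1 _ Kr) (c2 _ Kr) tK.
apply: near_eq_is_derive D.
near=> u; apply/cvg_lim => //; apply: cc; near: u.
by apply: (cvgr_norm_lt t).
Unshelve. all: by end_near. Qed.

(** Evaluation at 0 isolates the constant coefficient. Differentiation shifts the sequence, and the
    factor [n.+1] that it introduces is cancelled. *)
Lemma pseries_eq0 (R : realType) (c : nat -> R) :
  (\forall t \near (0 : R), pseries c t @ \oo --> (0 : R)) -> forall n, c n = 0.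
Proof.
move=> + n; elim: n c => [|n IH] c h.
  have h0 := nbhs_singleton h.
  have : pseries c 0 @ \oo --> c 0%N.
    rewrite -(cvg_shiftS (pseries c 0)).
    apply: cvg_near_cst; apply: nearW => m /=.
    rewrite /pseries/series/= big_nat_recl//= big1 ?addr0 ?mulr1//.
    by move=> i _; rewrite expr0n mulr0.
  by move=> /cvg_lim <-//; apply/cvg_lim.
have := IH (pseries_diffs c).
rewrite /pseries_diffs => H; apply/eqP; rewrite -(mulrI_eq0 _ (x := n.+1%:R)).
  apply/eqP/H.
  have := derive_pseries _ _ _ h; apply: filterS => t [l dl hl].
  suff -> : 0 = l by exact: hl.
  by rewrite -(@derive_val _ _ _ _ _ _ _ dl) derive_cst.
by apply/lregP; rewrite pnatr_eq0.
Qed.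

(** Coefficients of t^n are compared in (1 + lambda t) f' = g: f' contributes (n+1) c_(n+1) and t f'
    contributes n c_n. *)
Lemma pseries_ode (R : realType) (lambda : R) (c b : nat -> R)
    (f f' g : R -> R) :
  (\forall t \near (0 : R), pseries c t @ \oo --> f t) ->
  (\forall t \near (0 : R), pseries b t @ \oo --> g t) ->
  (\forall t \near (0 : R), is_derive (t : R) (1 : R) f (f' t)) ->
  (\forall t \near (0 : R), (1 + lambda * t) * f' t = g t) ->
  forall n, n.+1%:R * c n.+1 + lambda * n%:R * c n = b n.
Proof.
move=> hc hb hf hg n; apply/eqP; rewrite -subr_eq0; apply/eqP; move: n.
apply: (@pseries_eq0 R (fun n => n.+1%:R * c n.+1 + lambda * n%:R * c n - b n)).
have hd := derive_pseries _ _ _ hc.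
near=> t.
have [l dl hl] : exists2 l : R, is_derive (t : R) (1 : R) f l &
    pseries (pseries_diffs c) t @ \oo --> l by near: t.
have fl : f' t = l.
  have dt : is_derive (t : R) (1 : R) f (f' t) by near: t.
  by rewrite -(@derive_val _ _ _ _ _ _ _ dt) (@derive_val _ _ _ _ _ _ _ dl).
have gt : (1 + lambda * t) * f' t = g t by near: t.
have hbt : pseries b t @ \oo --> g t by near: t.
have hn : pseries (fun n => n%:R * c n) t @ \oo --> t * l.
  rewrite -(cvg_shiftS (pseries _ t)).
  have -> : (fun n => pseries (fun n => n%:R * c n) t n.+1) =
     (fun n => t * pseries (pseries_diffs c) t n).
    apply/funext => m; rewrite /pseries/series/= big_nat_recl//= !mul0r add0r.
    rewrite mulr_sumr; apply: eq_bigr => i _.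
    by rewrite /pseries_diffs exprS; ring.
  exact: cvgMr.
have -> : (0 : R) = l + lambda * (t * l) - g t by rewrite -gt fl; ring.
have -> : pseries (fun n => n.+1%:R * c n.+1 + lambda * n%:R * c n - b n) t =
  (fun n => pseries (pseries_diffs c) t n +
     lambda * pseries (fun n => n%:R * c n) t n - pseries b t n).
  apply/funext => m; rewrite /pseries/series/= mulr_sumr -big_split -sumrB/=.
  by apply: eq_bigr => i _; rewrite /pseries_diffs; ring.
by apply: cvgB => //; apply: cvgD => //; exact: cvgMr.
Unshelve. all: by end_near. Qed.

(** The boolean multiple puts zeros below k, which turns a sum starting at k into a full power
    series. *)
Lemma egf_expansion_from_pseries (R : realType) k (a : nat -> R) f :
  egf_expansion_from k a f ->
  \forall t \near (0 : R),
    pseries (fun n => a n *+ (k <= n)%N / n`!%:R) t @ \oo --> f t.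
Proof.
apply: filterS => t; apply: cvg_trans; apply: near_eq_cvg.
exists k => // N /= kN.
rewrite /pseries/series/= [RHS](big_cat_nat (leq0n k) kN)//=.
rewrite [X in _ = X + _]big_nat_cond [X in _ = X + _]big1 ?add0r.
  by apply: eq_big_nat => n /andP[kn _]; rewrite kn mulr1n mulrAC.
by move=> n /andP[/andP[_ nk] _]; rewrite leqNgt nk mulr0n !mul0r.
Qed.

(** With y_k = h^k / k!, the equation for h gives (1 + lambda t) y_k' = e k y_k + y_(k-1), because h
    y_(k-1) = k y_k. The recurrence is this equation read on coefficients. *)
Lemma egf_powers_rec (R : realType) (lambda e : R) (h h' : R -> R)
    (S : nat -> nat -> R) (s := fun n k => S n k *+ (k <= n)%N) :
  (forall k, egf_expansion_from k (fun n => S n k)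
    (fun t => k`!%:R^-1 * h t ^+ k)) ->
  (\forall t \near (0 : R), is_derive (t : R) (1 : R) h (h' t)) ->
  (\forall t \near (0 : R), (1 + lambda * t) * h' t = 1 + e * h t) ->
  s 0%N 0%N = 1 /\ forall n k, s n.+1 k =
    (e * k%:R - lambda * n%:R) * s n k + (if k is k'.+1 then s n k' else 0).
Proof.
move=> hS dh eh.
have hs k := egf_expansion_from_pseries _ _ _ _ (hS k).
have fact0 n : n`!%:R != 0 :> R by rewrite pnatr_eq0 -lt0n fact_gt0.
split.
  have h0 := nbhs_singleton (hs 0%N).
  have : pseries (fun n => S n 0%N *+ (0 <= n)%N / n`!%:R) 0 @ \oo -->
      s 0%N 0%N.
    rewrite -(cvg_shiftS (pseries _ 0)).
    apply: cvg_near_cst; apply: nearW => m /=.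
    rewrite /pseries/series/= big_nat_recl//= big1 ?addr0 ?mulr1 ?divr1//.
    by move=> i _; rewrite expr0n mulr0.
  move=> /cvg_lim <-//; apply/cvg_lim => //.
  by rewrite !expr0 invr1 mul1r in h0.
(* These encode h^(k-1) / (k-1)! by its coefficients and as a function. They are 0 for k = 0, where
   h^0 has derivative 0. *)
pose prev k n : R := if k is k'.+1 then s n k' else 0.
pose gprev k t : R := if k is k'.+1 then k'`!%:R^-1 * h t ^+ k' else 0.
have main k n :
    n.+1%:R * (s n.+1 k / n.+1`!%:R) + lambda * n%:R * (s n k / n`!%:R) =
    (e * k%:R * s n k + prev k n) / n`!%:R.
  apply: (pseries_ode R lambda (fun n => s n k / n`!%:R)
    (fun n => (e * k%:R * s n k + prev k n) / n`!%:R)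
    (fun t => k`!%:R^-1 * h t ^+ k)
    (fun t => k`!%:R^-1 * (k%:R * h t ^+ k.-1 * h' t))
    (fun t => e * k%:R * (k`!%:R^-1 * h t ^+ k) +
       gprev k t)) => //.
  - exact: hs.
  - have hk' : \forall t \near (0 : R),
       pseries (fun n => prev k n / n`!%:R) t @ \oo -->
       gprev k t.
      case: k => [|k]; last exact: hs.
      near=> t; rewrite [X in X @ _](_ : _ = fun=> 0); first exact: cvg_cst.
      apply/funext => m.
      by rewrite /pseries/series/= big1// => i _; rewrite !mul0r.
    near=> t.
    rewrite [X in X @ _](_ : _ = (fun N =>
        e * k%:R * pseries (fun n => s n k / n`!%:R) t N +
        pseries (fun n => prev k n / n`!%:R) t N)); last first.
      apply/funext => N; rewrite /pseries/series/= mulr_sumr -big_split/=.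
      by apply: eq_bigr => i _; ring.
    have hst : pseries (fun n => s n k / n`!%:R) t @ \oo -->
        k`!%:R^-1 * h t ^+ k.
      by near: t; exact: hs.
    have hkt : pseries (fun n => prev k n / n`!%:R) t @ \oo -->
       gprev k t by near: t; exact: hk'.
    by apply: cvgD => //; exact: cvgMr.
  - near=> t.
    have dt : is_derive (t : R) (1 : R) h (h' t) by near: t.
    have -> : (fun t => k`!%:R^-1 * h t ^+ k) = k`!%:R^-1 *: (h ^+ k).
      by apply/funext => u; rewrite fctE.
    apply: is_derive_eq.
    by rewrite /GRing.scale/= mulr_natl.
  - near=> t.
    have et : (1 + lambda * t) * h' t = 1 + e * h t by near: t.
    case: k => [|k]; first by rewrite /=; ring.
    rewrite /= factS natrM invfM exprS.
    transitivity (k`!%:R^-1 * h t ^+ k * ((1 + lambda * t) * h' t)).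
      by field; rewrite fact0 nat1r pnatr_eq0.
    by rewrite et; field; rewrite fact0 nat1r pnatr_eq0.
move=> n k.
have := main k n; rewrite factS natrM -/(prev k n).
rewrite [n.+1%:R * (_ / _)](_ : _ = s n.+1 k / n`!%:R); last first.
  by field; rewrite fact0 nat1r pnatr_eq0.
move=> /(canRL (addrK _)) H; apply: (mulIf (x := n`!%:R^-1)); last first.
  by rewrite H; ring.
by rewrite invr_eq0.
Unshelve. all: by end_near. Qed.

(** * The degenerate exponential and logarithm, and the Stirling recurrences *)

Lemma near0_1DM_gt0 (R : realType) (lambda : R) :
  \forall t \near (0 : R), 0 < 1 + lambda * t.
Proof.
have c : (1 + lambda * t) @[t --> (0 : R)] --> 1 + lambda * 0.
  by apply: cvgD; [exact: cvg_cst|apply: cvgMr; exact: cvg_id].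
by apply: (cvgr_gt _ c); rewrite mulr0 addr0.
Qed.

Lemma log_degenerate_expE (R : realType) (lambda : R) :
  log_degenerate_exp lambda =
  fun t => if lambda == 0 then t else lambda^-1 * ln (1 + lambda * t).
Proof.
apply/funext => t; rewrite /log_degenerate_exp; case: eqP => // _.
by rewrite ln_powR.
Qed.

Lemma degenerate_expE (R : realType) (lambda : R) :
  \forall t \near (0 : R),
    degenerate_exp lambda t = expR (log_degenerate_exp lambda t).
Proof.
near=> t; rewrite /degenerate_exp /log_degenerate_exp; case: eqP => // _.
by rewrite lnK// posrE powR_gt0//; near: t; exact: near0_1DM_gt0.
Unshelve. all: by end_near. Qed.

Lemma is_derive_log_degenerate_exp (R : realType) (lambda : R) :
  \forall t \near (0 : R),
    is_derive (t : R) (1 : R) (log_degenerate_exp lambda) (1 + lambda * t)^-1.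
Proof.
near=> t; rewrite log_degenerate_expE.
case: eqP => [->|/eqP l0].
  by rewrite mul0r addr0 invr1; exact: is_derive_id.
have t0 : 0 < 1 + lambda * t by near: t; exact: near0_1DM_gt0.
have d1 : is_derive (t : R) (1 : R) (fun t => 1 + lambda * t) lambda.
  have -> : (fun t : R => 1 + lambda * t) = cst 1 + lambda *: id by [].
  by apply: is_derive_eq; rewrite add0r /GRing.scale/= mulr1.
have d2 := @is_derive1_comp R (@ln R) (fun t => 1 + lambda * t) _ _ _
  (is_derive1_ln t0) d1.
have -> : (fun t => lambda^-1 * ln (1 + lambda * t)) =
  lambda^-1 *: (@ln R \o (fun t => 1 + lambda * t)) by [].
apply: is_derive_eq.
by rewrite /GRing.scale/= mulrC mulfK.
Unshelve. all: by end_near. Qed.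

Lemma is_derive_degenerate_exp (R : realType) (lambda : R) :
  \forall t \near (0 : R),
    is_derive (t : R) (1 : R) (fun t => degenerate_exp lambda t - 1)
      (degenerate_exp lambda t / (1 + lambda * t)).
Proof.
(* A derivative at t needs the two functions to agree on a neighbourhood of t, not only at t;
   [near_join] supplies this for every t near 0. *)
have H := near_join (degenerate_expE _ lambda).
near=> t.
have -> : degenerate_exp lambda t = expR (log_degenerate_exp lambda t).
  by near: t; exact: degenerate_expE.
have dt : is_derive (t : R) (1 : R) (log_degenerate_exp lambda)
    (1 + lambda * t)^-1.
  by near: t; exact: is_derive_log_degenerate_exp.
have d2 := is_derive1_comp (is_derive_expR (log_degenerate_exp lambda t)) dt.
apply: (@near_eq_is_derive _ _ _
  ((@expR R \o log_degenerate_exp lambda) - cst 1)).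
  have : \near t,
    degenerate_exp lambda t = expR (log_degenerate_exp lambda t) by near: t.
  by apply: filterS => u ->.
by apply: is_derive_eq; rewrite subr0.
Unshelve. all: by end_near. Qed.

Lemma degenerate_stirling1_rec (R : realType) (lambda : R) S
    (s := fun n k => S n k *+ (k <= n)%N) :
  degenerate_stirling1 lambda S ->
  s 0%N 0%N = 1 /\ forall n k,
    s n.+1 k = (if k is k'.+1 then s n k' else 0) - lambda * n%:R * s n k.
Proof.
move=> hS.
have [||s00 sS] := egf_powers_rec R lambda 0 (log_degenerate_exp lambda)
    (fun t => (1 + lambda * t)^-1) S hS.
- exact: is_derive_log_degenerate_exp.
- near=> t; rewrite mul0r addr0 divff// gt_eqF//.
  by near: t; exact: near0_1DM_gt0.
by split=> // n k; rewrite /s sS mul0r sub0r mulNr addrC.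
Unshelve. all: by end_near. Qed.

Lemma degenerate_stirling2_rec (R : realType) (lambda : R) S
    (s := fun n k => S n k *+ (k <= n)%N) :
  degenerate_stirling2 lambda S ->
  s 0%N 0%N = 1 /\ forall n k,
    s n.+1 k = (k%:R - lambda * n%:R) * s n k +
      (if k is k'.+1 then s n k' else 0).
Proof.
move=> hS.
have [||s00 sS] := egf_powers_rec R lambda 1
    (fun t => degenerate_exp lambda t - 1)
    (fun t => degenerate_exp lambda t / (1 + lambda * t)) S hS.
- exact: is_derive_degenerate_exp.
- near=> t; rewrite mul1r subrKC mulrC divfK// gt_eqF//.
  by near: t; exact: near0_1DM_gt0.
by split=> // n k; rewrite /s sS mul1r.
Unshelve. all: by end_near. Qed.

End ExponentialGeneratingFunctions.

(* The r-th moment of a sum of k independent uniform variables on (0, 1). *)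
Fixpoint irwin_hall_moment (R : realType) (k r : nat) : R :=
  if k is k'.+1 then
    \sum_(l < r.+1) 'C(r, l)%:R * irwin_hall_moment R k' l / (r - l).+1%:R
  else (r == 0)%:R.

Lemma irwin_hall_moment_ge0 (R : realType) k r : 0 <= irwin_hall_moment R k r.
Proof.
elim: k r => [|k IH] r /=; first exact: ler0n.
by apply: sumr_ge0 => l _; rewrite divr_ge0// mulr_ge0.
Qed.

(** * Moments of sums of independent uniform variables *)

Section UniformSumMoments.
Local Open Scope classical_set_scope.
Import HBNNSimple.
Context (d : measure_display) (T : measurableType d) (R : realType).
Context (P : probability T R).

(** The product rule assumed for indicators of [X] passes to simple functions by linearity, then to
    [h] by monotone convergence. Independence enters only through [X] tested against the weight
    [G]. *)
Lemma ge0_integral_mul_indep (X : {RV P >-> R}) (G : T -> R) (h : R -> R) :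
  measurable_fun setT G -> (forall w, 0 <= G w) ->
  measurable_fun setT h -> (forall x, 0 <= h x) ->
  (\int[P]_w (G w)%:E)%E \is a fin_num ->
  (forall B, measurable B ->
    (\int[P]_w (\1_B (X w) * G w)%:E = P (X @^-1` B) * \int[P]_w (G w)%:E)%E) ->
  (\int[P]_w (h (X w) * G w)%:E
   = \int[P]_w (h (X w))%:E * \int[P]_w (G w)%:E)%E.
Proof.
move=> mG G0 mh h0 Gfin hB.
have mX : measurable_fun setT X by [].
have mhE : measurable_fun [set: R] (fun x => (h x)%:E).
  exact/measurable_EFinP.
pose f_ := nnsfun_approx measurableT mhE.
have mfX n : measurable_fun setT (fun w => f_ n (X w)).
  exact: (measurableT_comp (f := f_ n)).
have f0 n x : 0 <= f_ n x by [].
have IG0 : (0 <= \int[P]_w (G w)%:E)%E.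
  by apply: integral_ge0 => w _; rewrite lee_fin.
have ndf x n m : (n <= m)%N -> f_ n x <= f_ m x.
  by move=> nm; exact/lefP/nd_nnsfun_approx.
have cvf x : (f_ n x)%:E @[n --> \oo] --> (h x)%:E.
  apply: (@cvg_nnsfun_approx _ _ _ _ measurableT _ mhE) => //= y _.
  by rewrite lee_fin.
have step n : (\int[P]_w (f_ n (X w) * G w)%:E
   = \int[P]_w (f_ n (X w))%:E * \int[P]_w (G w)%:E)%E.
  have mI y : measurable_fun setT (fun w => \1_(f_ n @^-1` [set y]) (X w) : R).
    have m1 : measurable_fun setT (\1_(f_ n @^-1` [set y]) : R -> R).
      by apply: measurable_indic; exact: measurable_sfunP.
    exact: (measurableT_comp m1).
  have y0 y x : 0 <= y * \1_(f_ n @^-1` [set y]) x :> R.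
    by rewrite -lee_fin EFinM nnfun_muleindic_ge0.
  have e1 w : (f_ n (X w) * G w)%:E = (\sum_(y \in range (f_ n))
      (y * \1_(f_ n @^-1` [set y]) (X w) * G w)%:E)%E.
    rewrite EFinM (fimfunE (f_ n)) -fsumEFin// ge0_mule_fsuml//.
    by move=> y; rewrite lee_fin.
  under eq_integral do rewrite e1.
  have e2 w : (f_ n (X w))%:E = (\sum_(y \in range (f_ n))
      (y * \1_(f_ n @^-1` [set y]) (X w))%:E)%E.
    by rewrite {1}(fimfunE (f_ n)) -fsumEFin.
  under [X in _ = (X * _)%E]eq_integral do rewrite e2.
  rewrite ge0_integral_fsum//; last 2 first.
  - move=> y; apply/measurable_EFinP; apply: measurable_funM => //.
    exact: measurable_funM.
  - by move=> y w _; rewrite lee_fin mulr_ge0.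
  rewrite ge0_integral_fsum//; last 2 first.
  - by move=> y; apply/measurable_EFinP; apply: measurable_funM.
  - by move=> y w _; rewrite lee_fin.
  rewrite ge0_mule_fsuml; last first.
    by move=> y; apply: integral_ge0 => w _; rewrite lee_fin.
  apply: eq_fsbigr => y /[!inE] -[x _ fxy].
  have yp : 0 <= y by rewrite -fxy.
  under eq_integral do rewrite -mulrA EFinM.
  under [X in _ = (X * _)%E]eq_integral do rewrite EFinM.
  rewrite ge0_integralZl//; last 2 first.
  - by apply/measurable_EFinP; exact: measurable_funM.
  - by move=> w _; rewrite lee_fin mulr_ge0// indicE.
  rewrite ge0_integralZl//; last exact/measurable_EFinP.
  have mB : measurable (f_ n @^-1` [set y]) by exact: measurable_sfunP.
  rewrite hB// -muleA; congr (_ * (_ * _))%E.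
  rewrite -[RHS]/(\int[P]_w (\1_(X @^-1` (f_ n @^-1` [set y])) w)%:E)%E.
  rewrite integral_indic ?setIT//.
  by rewrite -[X in measurable X]setTI; exact: mX.
transitivity (lim (\int[P]_w (f_ n (X w) * G w)%:E @[n --> \oo])%E).
  rewrite -monotone_convergence//=.
  - apply: eq_integral => w _; apply/esym/cvg_lim => //=.
    rewrite EFinM; under eq_fun do rewrite EFinM.
    exact: cvgeZr.
  - by move=> n; apply/measurable_EFinP; exact: measurable_funM.
  - by move=> n w _; rewrite lee_fin mulr_ge0.
  - by move=> w _ n m nm; rewrite lee_fin ler_wpM2r// ndf.
rewrite [X in _ = (X * _)%E](_ : _ = lim
    (\int[P]_w (f_ n (X w))%:E @[n --> \oo])%E); last first.
  rewrite -monotone_convergence//=.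
  - by apply: eq_integral => w _; apply/esym/cvg_lim.
  - by move=> n; apply/measurable_EFinP.
  - by move=> n w _; rewrite lee_fin.
  - by move=> w _ n m nm; rewrite lee_fin ndf.
(* Finiteness of the integral of [G] lets this constant factor pass through the limit. *)
rewrite -limeMr//; first by congr (lim _); under eq_fun do rewrite step.
apply/ereal_nondecreasing_is_cvgn => n m nm; apply: ge0_le_integral => //=.
- by move=> w _; rewrite lee_fin.
- exact/measurable_EFinP.
- exact/measurable_EFinP.
- by move=> w _; rewrite lee_fin ndf.
Qed.

(** The negative half-line does not meet [0, 1], so the law gives it measure 0. This serves to drop
    absolute values. *)
Lemma ae_uniform01_ge0 (X : {RV P >-> R}) : uniform01 X ->
  {ae P, forall w, 0 <= X w}.
Proof.
move=> uX; exists (X @^-1` `]-oo, 0[); split.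
- by rewrite -[X in measurable X]setTI; exact: measurable_funP.
- have := uX `]-oo, 0[%classic (measurable_itv _).
  rewrite /distribution /pushforward => ->; rewrite /uniform_prob.
  rewrite integral_uniform_pdf (_ : _ `&` _ = set0) ?integral_set0//.
  rewrite -subset0 => x /= []; rewrite !in_itv/= => x0 /andP[].
  by rewrite leNgt x0.
- by move=> w /= /negP; rewrite -ltNge in_itv.
Qed.

(** The absolute value makes the integrand nonnegative everywhere, so the change of variables for
    nonnegative functions applies. What remains is the integral of x^n over [0, 1]. *)
Lemma uniform01_moment (X : {RV P >-> R}) n : uniform01 X ->
  (\int[P]_w (`|X w| ^+ n)%:E = (n.+1%:R^-1)%:E)%E.
Proof.
move=> uX.
pose f := fun x : R => (`|x| ^+ n)%:E.
have mf : measurable_fun [set: R] f.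
  by apply/measurable_EFinP; apply: measurable_funX; exact: normr_measurable.
have f0 x : (0 <= f x)%E by rewrite lee_fin exprn_ge0.
rewrite -[LHS]/(\int[P]_w f (X w))%E.
(* [Y] is [X] with its codomain read as [measurableTypeR R], so that its law and the uniform
   probability are compared on the same measurable type. *)
pose Y : T -> measurableTypeR R := X.
have mY : measurable_fun setT Y by move=> _ B mB; exact: measurable_funPT.
pose Y' : {RV P >-> measurableTypeR R} :=
  HB.pack Y (isMeasurableFun.Build _ _ _ _ Y mY).
transitivity (\int[distribution P Y']_x f x)%E.
  by rewrite ge0_integral_distribution.
transitivity (\int[uniform_prob (@ltr01 R)]_x f x)%E.
  by apply: eq_measure_integral => A mA _; exact: uX.
rewrite integral_uniform// subr0 invr1 mul1e.
transitivity (\int[@lebesgue_measure R]_(x in `[0%R, 1%R]) (x ^+ n)%:E)%E.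
  apply: eq_integral => x /[!inE]/=; rewrite in_itv/= /f => /andP[x0 _].
  by rewrite ger0_norm.
have dF (x : R) : is_derive x 1 (fun x : R => x ^+ n.+1 / n.+1%:R) (x ^+ n).
  have -> : (fun x : R => x ^+ n.+1 / n.+1%:R) = n.+1%:R^-1 *: (@id R) ^+ n.+1.
    by apply/funext => y /=; rewrite mulrC fctE.
  apply: is_derive_eq.
  by rewrite /GRing.scale/= mulr1 mulrnAl mul1r -[X in _ * X]mulr_natl mulKf.
have cF : continuous (fun x : R => x ^+ n.+1 / n.+1%:R).
  move=> x; apply: differentiable_continuous; apply/derivable1_diffP.
  by have [] := dF x.
rewrite (@continuous_FTC2 _ _ (fun x => x ^+ n.+1 / n.+1%:R))//.
- by rewrite expr1n expr0n mul0r sube0 mul1r.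
- by apply: continuous_subspaceT => x; exact: exprn_continuous.
- split.
  + by move=> x _; have [] := dF x.
  + by apply: cvg_at_right_filter; exact: cF.
  + by apply: cvg_at_left_filter; exact: cF.
- by move=> x _; rewrite derive1E; have [_] := dF x.
Qed.

(* Keeping the indicators of the variables not yet summed lets the induction on
   j start from the set-level definition of independence. *)
Lemma indicator_partial_sum_moment k (U : 'I_k -> {RV P >-> R}) :
  mutually_independent U -> (forall i, uniform01 (U i)) ->
  forall j r (B : 'I_k -> set R), (j <= k)%N -> (forall i, measurable (B i)) ->
  (\int[P]_w ((\sum_(i < k | (i < j)%N) `|U i w|) ^+ r *
              \prod_(i < k | (j <= i)%N) \1_(B i) (U i w))%:E =
   (irwin_hall_moment R j r)%:E *
   \prod_(i < k | (j <= i)%N) P (U i @^-1` B i))%E.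
Proof.
move=> iU uU; elim=> [|j IH] r B jk mB.
  (* No variable is summed yet: the product of all indicators is the indicator of one intersection,
     and independence is applied to the full index set. *)
  have -> : (\prod_(i < k | (0 <= i)%N) P (U i @^-1` B i))%E =
      P (\bigcap_(i in [set` [set: 'I_k]%SET]) (U i @^-1` B i)).
    by rewrite iU//; apply: eq_bigl => i; rewrite inE.
  have mI : measurable (\bigcap_(i in [set` [set: 'I_k]%SET]) (U i @^-1` B i)).
    apply: fin_bigcap_measurable => [//|i _].
    by rewrite -[X in measurable X]setTI; exact: measurable_funP.
  rewrite -[X in (_ * P X)%E]setIT -integral_indic// -ge0_integralZl//;
    last 2 first.
  - exact/measurable_EFinP.
  - by rewrite lee_fin ler0n.
  apply: eq_integral => w _; rewrite -EFinM; congr ((_ * _)%:E).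
    (* The empty sum to the power r is 0^r, with 0^0 = 1, which is the moment for zero variables. *)
    by rewrite big_pred0//= expr0n.
  have [wI|wI] := pselect
    ((\bigcap_(i in [set` [set: 'I_k]%SET]) (U i @^-1` B i)) w).
    rewrite [RHS]indicE mem_set// big1// => i _.
    by rewrite indicE mem_set//; apply: wI => /=; rewrite inE.
  rewrite [RHS]indicE memNset//.
  have [i Bi] : exists i, ~ B i (U i w).
    apply/not_existsP => h; apply: wI => i _ /=.
    by apply: contrapT; exact: h.
  by rewrite (bigD1 i)//= indicE memNset// mul0r.
pose j' := Ordinal jk.
have ltj (i : 'I_k) : (j <= i)%N && (i != j') = (j < i)%N.
  by rewrite ltn_neqAle -val_eqE/= andbC eq_sym.
have ltjS (i : 'I_k) : (i < j.+1)%N && (i != j') = (i < j)%N.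
  by rewrite ltnS ltn_neqAle -val_eqE/= andbC.
pose F l w := (\sum_(i < k | (i < j)%N) `|U i w|) ^+ l *
              \prod_(i < k | (j < i)%N) \1_(B i) (U i w).
have mF l : measurable_fun setT (F l).
  apply: measurable_funM; under eq_fun do rewrite big_mkcond/=.
    apply: measurable_funX; apply: measurable_sum => i.
    by case: (i < j)%N => //; exact: measurableT_comp.
  apply: measurable_prod => i _; case: (j < i)%N => //.
  exact: (measurableT_comp (measurable_indic (mB i))).
have F0 l w : 0 <= F l w.
  apply: mulr_ge0; first by apply: exprn_ge0; apply: sumr_ge0.
  by apply: prodr_ge0 => i _; rewrite indicE.
(* Replacing the set at [j'] by [C] in the induction hypothesis isolates the factor of [U j']. With
   [intF], this becomes the product rule required by [ge0_integral_mul_indep]. *)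
have split l C : measurable C ->
    (\int[P]_w (\1_C (U j' w) * F l w)%:E =
     P (U j' @^-1` C) * ((irwin_hall_moment R j l)%:E *
       \prod_(i < k | (j < i)%N) P (U i @^-1` B i)))%E.
  move=> mC.
  have := IH l (fun i => if i == j' then C else B i) (ltnW jk).
    have ji (i : 'I_k) : (j < i)%N -> (if i == j' then C else B i) = B i.
    by rewrite -ltj => /andP[_ /negbTE ->].
  rewrite (bigD1 j')//= eqxx (eq_bigl _ _ ltj) muleCA.
  under eq_bigr => i /ji -> do [].
  move=> <-; last by move=> i; case: ifP.
  apply: eq_integral => w _; rewrite /F mulrCA.
  rewrite [\prod_(i < k | (j <= i)%N) _](bigD1 j')//= eqxx (eq_bigl _ _ ltj).
  by congr ((_ * (_ * _))%:E); apply: eq_bigr => i /ji ->.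
have intF l : (\int[P]_w (F l w)%:E =
    (irwin_hall_moment R j l)%:E *
    \prod_(i < k | (j < i)%N) P (U i @^-1` B i))%E.
  have := split l setT measurableT.
  rewrite preimage_setT probability_setT mul1e => <-.
  by apply: eq_integral => w _; rewrite indicE in_setT mul1r.
have finF l : (\int[P]_w (F l w)%:E)%E \is a fin_num.
  rewrite intF fin_numM// prode_fin_num// => i _.
  apply: fin_num_measure.
  by rewrite -[X in measurable X]setTI; exact: measurable_funP.
(* Binomial expansion in powers of |U_j'|. Since the moment of order r - l is 1 / (r - l + 1), the
   terms integrate to those of the recursion for [irwin_hall_moment]. *)
transitivity (\int[P]_w (\sum_(l < r.+1) 
   (('C(r, l)%:R)%:E * (`|U j' w| ^+ (r - l) * F l w)%:E)))%E.
  apply: eq_integral => w _.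
  rewrite (bigD1 j')//= (eq_bigl _ _ ltjS) exprDn big_distrl/= -sumEFin.
  apply: eq_bigr => l _; rewrite -EFinM; congr EFin.
  by rewrite /F -mulr_natl -!mulrA.
have mUF l : measurable_fun setT (fun w => `|U j' w| ^+ (r - l) * F l w).
  apply: measurable_funM => //; apply: measurable_funX; exact: measurableT_comp.
rewrite ge0_integral_sum//; last 2 first.
- move=> l; under eq_fun do rewrite -EFinM.
  by apply/measurable_EFinP; exact: measurable_funM.
- by move=> l w _; rewrite -EFinM lee_fin mulr_ge0// mulr_ge0// exprn_ge0.
rewrite /= -sumEFin ge0_sume_distrl; last first.
  by move=> l _; rewrite lee_fin divr_ge0// mulr_ge0// irwin_hall_moment_ge0.
apply: eq_bigr => l _.
rewrite ge0_integralZl//.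
rewrite (ge0_integral_mul_indep (U j') (F l) (fun x => `|x| ^+ (r - l)))//.
- rewrite uniform01_moment// intF muleA muleA; congr (_ * _)%E.
  by rewrite -!EFinM mulrAC.
- by apply: measurable_funX; exact: normr_measurable.
- by move=> C mC; rewrite split// intF.
- by apply/measurable_EFinP.
- by move=> w _; rewrite lee_fin mulr_ge0// exprn_ge0.
Qed.

(** This is the case j = k, where no indicator is left; the absolute values are removed almost
    everywhere. *)
Lemma expectation_sum_uniform01X k (U : 'I_k -> {RV P >-> R}) r :
  mutually_independent U -> (forall i, uniform01 (U i)) ->
  ('E_P[fun w => ((\sum_(i < k) U i w) ^+ r)%R] =
   (irwin_hall_moment R k r)%:E)%E.
Proof.
move=> iU uU; rewrite unlock.
have := indicator_partial_sum_moment k U iU uU k r _ (leqnn k)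
  (fun=> measurableT).
have nk (i : 'I_k) : (k <= i)%N = false by rewrite leqNgt ltn_ord.
rewrite [X in _ = (_ * X)%E](eq_bigl _ _ nk) big_pred0_eq mule1 => <-.
apply: ae_eq_integral => //.
- apply/measurable_EFinP; apply: measurable_funX.
  exact: measurable_sum.
- apply/measurable_EFinP; apply: measurable_funM.
    apply: measurable_funX; under eq_fun do rewrite big_mkcond/=.
    apply: measurable_sum => i; case: (i < k)%N => //; exact: measurableT_comp.
  under eq_fun do rewrite (eq_bigl _ _ nk) big_pred0_eq.
  exact: measurable_cst.
- have h : {ae P, forall w, forall i, 0 <= U i w}.
    apply: filter_forall => i; exact: ae_uniform01_ge0.
  apply: filterS h => w h _; congr (_%:E).
  rewrite [X in _ = _ * X]big_pred0// mulr1; congr (_ ^+ _).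
  by apply: eq_big => i; [rewrite ltn_ord|rewrite ger0_norm].
Qed.

End UniformSumMoments.

(** * Forward differences of polynomials *)

Definition poly_diff (R : comNzRingType) (p : {poly R}) : {poly R} :=
  p \Po ('X + 1) - p.
Arguments poly_diff {R} p.

Lemma iter_poly_diffD (R : comNzRingType) k (p q : {poly R}) :
  iter k poly_diff (p + q) =
  iter k poly_diff p + iter k poly_diff q.
Proof.
elim: k p q => [//|k IH] p q; rewrite !iterS IH /poly_diff comp_polyD; ring.
Qed.

Lemma iter_poly_diffZ (R : comNzRingType) k a (p : {poly R}) :
  iter k poly_diff (a *: p) = a *: iter k poly_diff p.
Proof.
by elim: k p => [//|k IH] p; rewrite !iterS IH /poly_diff comp_polyZ scalerBr.
Qed.

Lemma iter_poly_diff_sum (R : comNzRingType) k n (F : nat -> {poly R}) :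
  iter k poly_diff (\sum_(i < n) F i) =
  \sum_(i < n) iter k poly_diff (F i).
Proof.
elim: n => [|n IH]; last by rewrite !big_ord_recr/= iter_poly_diffD IH.
rewrite !big_ord0; elim: k => //= k ->.
by rewrite /poly_diff comp_poly0 subr0.
Qed.

(** A Leibniz rule: Delta (x q) = x Delta q + q(x+1) with q(x+1) = Delta q + q, and each further
    difference adds one more copy of the last term. *)
Lemma iter_poly_diffXM (R : comNzRingType) k (p : {poly R}) :
  iter k.+1 poly_diff ('X * p) = 'X * iter k.+1 poly_diff p +
    (iter k.+1 poly_diff p + iter k poly_diff p) *+ k.+1.
Proof.
have base (q : {poly R}) :
    poly_diff ('X * q) = 'X * poly_diff q + (poly_diff q + q).
  by rewrite /poly_diff comp_polyM comp_polyX; ring.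
elim: k p => [|k IH] p; first by rewrite /= base mulr1n.
rewrite iterSr base iter_poly_diffD IH (iter_poly_diffD _ _ (poly_diff p) p).
rewrite -!iterSr [in RHS]mulrSr.
by rewrite -addrA.
Qed.

(** Multiplied by l! (r-l)!, both sides become (r+k+1)!. The identity matches the coefficients of
    the difference recursion with those of the moment recursion. *)
Lemma bin_mul_ffact k r l : (l <= r)%N ->
  ('C(r + k.+1, k + l) * (k + l) ^_ k * (r - l).+1 =
   (r + k.+1) ^_ k.+1 * 'C(r, l))%N.
Proof.
move=> lr; apply/eqP.
rewrite -(@eqn_pmul2r (l`! * (r - l)`!)) ?muln_gt0 ?fact_gt0//; apply/eqP.
have leC : (k + l <= r + k.+1)%N by rewrite addnS addnC ltnW// ltnS leq_add2r.
transitivity ((r + k.+1)`!)%N.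
  have Dl : (r + k.+1 - (k + l) = (r - l).+1)%N.
    by rewrite addnS addnC subSn ?leq_add2l// subnDl.
  rewrite -(bin_fact leC) Dl factS -(ffact_fact (leq_addr l k)) addKn.
  by rewrite -!mulnA; congr (_ * (_ * _))%N; rewrite mulnCA.
by rewrite -mulnA bin_fact// -(ffact_fact (leq_addl r k.+1)) addnK.
Qed.

(** Induction on k through Delta x^m = sum over l < m of C(m,l) x^l, which reproduces the recursion
    of the moments. *)
Lemma iter_poly_diffXn0 (R : realType) k m :
  (iter k poly_diff 'X^m).[0] = (m ^_ k)%:R * irwin_hall_moment R k (m - k).
Proof.
elim: k m => [|k IH] m.
  by rewrite /= subn0 mul1r hornerXn expr0n.
rewrite iterSr.
have -> : poly_diff 'X^m = \sum_(l < m) 'C(m, l)%:R *: 'X^l :> {poly R}.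
  rewrite /poly_diff comp_Xn_poly [_ + 1]addrC exprDn big_ord_recr/=.
  rewrite expr1n mul1r binn mulr1n addrK; apply: eq_bigr => i _.
  by rewrite expr1n mul1r scaler_nat.
rewrite (iter_poly_diff_sum _ k m (fun l => 'C(m, l)%:R *: 'X^l)) horner_sum.
under eq_bigr do rewrite iter_poly_diffZ hornerZ IH.
(* For m <= k both sides vanish through their falling factorials, so the truncated subtraction m -
   (k+1) does no harm. *)
have [mk|km] := leqP m k.
  rewrite ffact_small// mul0r big1// => l _.
  by rewrite ffact_small ?mul0r ?mulr0// (leq_trans (ltn_ord l)).
rewrite -(subnK km); set r := (m - k.+1)%N.
rewrite (addnK k.+1 r).
(* With m = r + k + 1, the indices below k contribute 0 and the others are renamed k + l with l <=
   r. *)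
rewrite [RHS]/= mulr_sumr addnS -addSn addnC big_split_ord/=.
rewrite big1 ?add0r; last first.
  by move=> l _; rewrite ffact_small ?mul0r ?mulr0.
apply: eq_bigr => l _.
rewrite addKn !mulrA -natrM -[RHS]mulrA mulrAC.
have lr : (l <= r)%N by rewrite -ltnS.
rewrite [(k + r.+1)%N]addnC addSnnS -(bin_mul_ffact _ _ _ lr) !natrM.
rewrite -[RHS]mulrA [_.+1%:R * _]mulrCA mulfV ?pnatr_eq0// mulr1.
by rewrite mulrAC.
Qed.

Lemma iter_poly_diff0_rec (R : realType) k (a : R) (p : {poly R}) :
  (iter k poly_diff (('X - a%:P) * p)).[0] =
  (k%:R - a) * (iter k poly_diff p).[0] + k%:R * (iter k.-1 poly_diff p).[0].
Proof.
rewrite mulrBl iter_poly_diffD mul_polyC -scaleNr iter_poly_diffZ.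
rewrite hornerD hornerZ.
(* For k = 0 the truncated predecessor [k.-1] is harmless, since its term carries the factor k. *)
case: k => [|k]; first by rewrite /= hornerM hornerX !mul0r add0r addr0 sub0r.
rewrite iter_poly_diffXM hornerD hornerM hornerX mul0r add0r hornerMn hornerD.
by rewrite -mulr_natl; ring.
Qed.

(** * Degenerate falling factorials and the Stirling identity *)

Lemma degenerate_ffact_rec (R : realType) (lambda : R) S n
    (p := fun n => \poly_(m < n.+1) S n m) :
  degenerate_stirling1 lambda S ->
  p 0%N = 1 /\ p n.+1 = ('X - (lambda * n%:R)%:P) * p n.
Proof.
move=> /degenerate_stirling1_rec[s00 sS].
have pE m i : (p m)`_i = S m i *+ (i <= m)%N.
  by rewrite coef_poly ltnS; case: leqP.
split.
  by apply/polyP => i; rewrite pE coef1; case: i.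
(* On coefficients, the recurrence of the first kind is multiplication by x - lambda n, the factor
   that leads from (x)_{n,lambda} to the next falling factorial. *)
apply/polyP => i; rewrite pE sS mulrBl coefB coefXM coefCM !pE.
by case: i.
Qed.

(** Both sides satisfy a(n+1,k) = (k - lambda n) a(n,k) + k a(n,k-1), the right one because k! = k
    (k-1)!, and they agree at n = 0. *)
Lemma poly_diff_degenerate_ffact (R : realType) (lambda : R) S1 S2 n k :
  degenerate_stirling1 lambda S1 -> degenerate_stirling2 lambda S2 ->
  (iter k poly_diff (\poly_(m < n.+1) S1 n m)).[0] =
  k`!%:R * (S2 n k *+ (k <= n)%N).
Proof.
move=> h1 /degenerate_stirling2_rec[s00 sS].
elim: n k => [|n IH] k.
  have [-> _] := degenerate_ffact_rec _ _ _ 0 h1.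
  rewrite -[1]/('X^0) iter_poly_diffXn0; case: k => [|k].
    by rewrite s00 mulr1.
  by rewrite ffact_small// mul0r mulr0.
have [_ ->] := degenerate_ffact_rec _ _ _ n h1.
rewrite iter_poly_diff0_rec !IH sS; case: k => [|k] /=; first by ring.
by rewrite factS natrM; ring.
Qed.

Theorem theorem7 (R : realType) (lambda : R) (S1 S2 : nat -> nat -> R)
    (hS1 : degenerate_stirling1 lambda S1)
    (hS2 : degenerate_stirling2 lambda S2)
    (k n : nat) (hkn : (k <= n)%N)
    (d : measure_display) (T : measurableType d) (P : probability T R)
    (U : 'I_k -> {RV P >-> R})
    (hindep : mutually_independent U)
    (hunif : forall i : 'I_k, uniform01 (U i)) :
  (S2 n k)%:E =
  (\sum_(k <= m < n.+1)
     (('C(m, k)%:R * S1 n m)%R)%:E *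
     'E_P[fun w : T => ((\sum_(i < k) U i w) ^+ (m - k))%R])%E.
Proof.
under eq_bigr do rewrite expectation_sum_uniform01X// -EFinM.
rewrite sumEFin; congr EFin.
(* The factor k! turns C(m,k) into the falling factorial that appears in [iter_poly_diffXn0]. *)
apply: (mulfI (x := k`!%:R)); first by rewrite pnatr_eq0 -lt0n fact_gt0.
have := poly_diff_degenerate_ffact _ _ _ _ n k hS1 hS2.
rewrite hkn mulr1n => <-; rewrite poly_def.
rewrite (iter_poly_diff_sum _ k n.+1 (fun m => S1 n m *: 'X^m)) horner_sum.
rewrite mulr_sumr.
rewrite -(big_mkord xpredT (fun m => (iter k poly_diff (S1 n m *: 'X^m)).[0])).
(* The indices m < k drop out because the k-th difference of x^m vanishes at 0. *)
rewrite (big_cat_nat (leq0n k) (leqW hkn))/= big_nat_cond big1 ?add0r.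
  apply: eq_bigr => m _; rewrite iter_poly_diffZ hornerZ iter_poly_diffXn0.
  by rewrite -bin_ffact natrM; ring.
move=> m /andP[/andP[_ mk] _].
by rewrite iter_poly_diffZ hornerZ iter_poly_diffXn0 ffact_small// mul0r mulr0.
Qed.
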